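(* Let $X$ be a locally compact metric space and $\Gamma$ a pseudo*group of local homeomorphisms of $X$ which is minimal and equicontinuous. Let $X_0$ be a nonempty relatively compact open subset of $X$ and let $\Gamma_0=\{\gamma\in\Gamma\mid \mathrm{Dom}(\gamma)\cup\mathrm{Range}(\gamma)\subset X_0\}$. Then there exists a nonzero finite $\Gamma_0$-invariant Radon measure $\mu$ on $X_0$.
   Context: A local homeomorphism of $X$ is a homeomorphism $\gamma$ from an open subset $\mathrm{Dom}(\gamma)$ onto an open subset $\mathrm{Range}(\gamma)$. A pseudo*group is a set $\Gamma$ of local homeomorphisms such that: (1) if $\gamma\in\Gamma$ and $U\subset\mathrm{Dom}(\gamma)$ is open then $\gamma|_U\in\Gamma$; (2) the identity of $X$ is in $\Gamma$; (3) if $\gamma,\gamma'\in\Gamma$ and $\mathrm{Dom}(\gamma')=\mathrm{Range}(\gamma)$ then $\gamma'\circ\gamma\in\Gamma$; (4) if $\gamma\in\Gamma$ then $\gamma^{-1}\in\Gamma$ (no axiom of taking unions is assumed). $\Gamma$ is minimal if for every $x\in X$ the orbit $\{\gamma x\mid\gamma\in\Gamma, x\in\mathrm{Dom}(\gamma)\}$ is dense in $X$. $\Gamma$ is equicontinuous if for every $\epsilon>0$ there is $\delta(\epsilon)>0$ such that whenever $\gamma\in\Gamma$, $x,x'\in\mathrm{Dom}(\gamma)$ and $d(x,x')<\delta(\epsilon)$, we have $d(\gamma x,\gamma x')\le\epsilon$. A Radon measure $\mu$ on $X_0$ is $\Gamma_0$-invariant if $\mu(\zeta\circ\gamma^{-1})=\mu(\zeta)$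 for all $\gamma\in\Gamma_0$ and all compactly supported continuous $\zeta$ on $X_0$ with $\mathrm{supp}\,\zeta\subset\mathrm{Dom}(\gamma)$, where $\zeta\circ\gamma^{-1}$ is extended by $0$ outside $\mathrm{Range}(\gamma)$. *)

(* Defs.v *)
From HB Require Import structures.
From mathcomp Require Import all_boot all_order all_algebra.
From mathcomp Require Import all_classical all_reals all_analysis.
Set Implicit Arguments. Unset Strict Implicit. Unset Printing Implicit Defensive.
Import Order.TTheory GRing.Theory Num.Theory.
Import numFieldNormedType.Exports.
Local Open Scope classical_set_scope.
Local Open Scope ring_scope.

Definition is_metric_of (R : realType) (X : topologicalType) (d : X -> X -> R) :=
  [/\ (forall x y, 0 <= d x y),
      (forall x y, d x y = 0 <-> x = y),
      (forall x y, d x y = d y x),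
      (forall x y z, d x z <= d x y + d y z)
    & (forall (x : X) (A : set X),
         nbhs x A <-> exists2 r : R, 0 < r & [set y | d x y < r] `<=` A)].

(* A local homeomorphism of X: a homeomorphism lh_fun from the open set lh_dom
   onto the open set lh_ran, with inverse lh_inv (values outside the domains
   are irrelevant). *)
Record LocalHomeo (X : topologicalType) := {
  lh_dom : set X;
  lh_ran : set X;
  lh_fun : X -> X;
  lh_inv : X -> X;
  lh_open_dom : open lh_dom;
  lh_open_ran : open lh_ran;
  lh_fun_in : forall x, lh_dom x -> lh_ran (lh_fun x);
  lh_inv_in : forall y, lh_ran y -> lh_dom (lh_inv y);
  lh_invK : forall x, lh_dom x -> lh_inv (lh_fun x) = x;
  lh_funK : forall y, lh_ran y -> lh_fun (lh_inv y) = y;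
  lh_cont_fun : {within lh_dom, continuous lh_fun};
  lh_cont_inv : {within lh_ran, continuous lh_inv}
}.

Definition represents (X : topologicalType) (g : LocalHomeo X) (U : set X)
  (f : X -> X) := lh_dom g = U /\ forall x, U x -> lh_fun g x = f x.

(* Pseudo*group (no union axiom); a partial map is in Gamma when some
   representative record is. *)
Definition pseudo_star_group (X : topologicalType) (G : set (LocalHomeo X)) :=
  [/\ (forall g U, G g -> open U -> U `<=` lh_dom g ->
         exists2 h, G h & represents h U (lh_fun g)),
      (exists2 h, G h & represents h setT id),
      (forall g g', G g -> G g' -> lh_dom g' = lh_ran g ->
         exists2 h, G h & represents h (lh_dom g) (lh_fun g' \o lh_fun g))
    & (forall g, G g -> exists2 h, G h & represents h (lh_ran g) (lh_inv g))].

Definition orbit_psg (X : topologicalType) (G : set (LocalHomeo X)) (x : X) : set X :=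
  [set y | exists2 g, G g & lh_dom g x /\ lh_fun g x = y].

Definition minimal_psg (X : topologicalType) (G : set (LocalHomeo X)) :=
  forall x, dense (orbit_psg G x).

Definition equicontinuous_psg (R : realType) (X : topologicalType)
  (d : X -> X -> R) (G : set (LocalHomeo X)) :=
  forall eps : R, 0 < eps -> exists2 delta : R, 0 < delta &
    forall g x x', G g -> lh_dom g x -> lh_dom g x' -> d x x' < delta ->
      d (lh_fun g x) (lh_fun g x') <= eps.

Definition restrict_psg (X : topologicalType) (G : set (LocalHomeo X)) (X0 : set X) :=
  [set g | G g /\ lh_dom g `|` lh_ran g `<=` X0].

(* Compactly supported continuous real functions on the open set X0, viewed
   (extended by 0) as functions on X: continuous on X with compact support
   contained in X0. *)
Definition support (R : realType) (X : topologicalType) (f : X -> R) : set X :=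
  closure [set x | f x != 0].

Definition Cc (R : realType) (X : topologicalType) (X0 : set X) (f : X -> R) :=
  continuous f /\ compact (support f) /\ support f `<=` X0.

Definition radon_measure (R : realType) (X : topologicalType) (X0 : set X)
  (mu : (X -> R) -> R) :=
  (forall (a b : R) f g, Cc X0 f -> Cc X0 g ->
      mu (fun x => a * f x + b * g x) = a * mu f + b * mu g) /\
  (forall f, Cc X0 f -> (forall x, 0 <= f x) -> 0 <= mu f).

Definition finite_radon (R : realType) (X : topologicalType) (X0 : set X)
  (mu : (X -> R) -> R) :=
  exists M : R, forall f, Cc X0 f -> (forall x, 0 <= f x <= 1) -> mu f <= M.

Definition nonzero_radon (R : realType) (X : topologicalType) (X0 : set X)
  (mu : (X -> R) -> R) := exists2 f, Cc X0 f & mu f != 0.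

Definition push (R : realType) (X : topologicalType) (g : LocalHomeo X)
  (f : X -> R) : X -> R :=
  fun y => if `[< lh_ran g y >] then f (lh_inv g y) else 0.

Definition invariant_radon (R : realType) (X : topologicalType) (X0 : set X)
  (G0 : set (LocalHomeo X)) (mu : (X -> R) -> R) :=
  forall g f, G0 g -> Cc X0 f -> support f `<=` lh_dom g -> mu (push g f) = mu f.

(* Main.v *)
Require Import Defs.
From HB Require Import structures.
From mathcomp Require Import all_boot all_order all_algebra.
From mathcomp Require Import all_classical all_reals all_analysis.
From mathcomp Require Import lra.
Set Implicit Arguments. Unset Strict Implicit. Unset Printing Implicit Defensive.
Import Order.TTheory GRing.Theory Num.Theory.
Import numFieldNormedType.Exports.
Local Open Scope classical_set_scope.
Local Open Scope ring_scope.

(** The proof is Haar's construction with covering numbers. Fix [x0] in [X0] and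
    let [S_r] be the family of all sets that some element of [G] maps into the
    ball [B(x0, r)]. The fractional covering number [p_r f], the infimum of
    [\sum_i c_i] over [f <= \sum_i c_i \1_(A_i)] with [A_i] in [S_r], is
    [G]-invariant and sublinear; it is finite by minimality and compactness.
    Equicontinuity of the inverses makes the members of [S_r] uniformly small as
    [r] tends to [0], so [p_r] becomes additive in the limit: the functional is
    the limit along an ultrafilter of [p_r f / p_r \1_K], [K] the closure of
    [X0]. Mass does not escape to the boundary of [X0]: by minimality finitely
    many elements of [G] carry pieces covering [K] into any given ball, so
    [p_r \1_K] is at most a constant times [p_r] of a bump function at [x0],
    uniformly in [r]. *)

(** * Compactness and limits along an ultrafilter *)

(** Stability under unions turns the supersets of [P]-sets into a filter base; the near-covering
    form of compactness then yields a single [P]-set containing [K]. This replaces the extraction of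
    finite subcovers. *)
Lemma compact_local_ind (X : topologicalType) (K : set X) (P : set X -> Prop) :
  compact K -> P set0 -> (forall A B, A `<=` B -> P B -> P A) ->
  (forall A B, P A -> P B -> P (A `|` B)) ->
  (forall x, K x -> exists2 U, nbhs x U & P U) -> P K.
Proof.
move=> /compact_near_coveringP Kc P0 Psub PU Ploc.
pose F : set_system (set X) := filter_from P (fun A => [set B | A `<=` B]).
have FF : Filter F.
  apply: filter_from_filter; first by exists set0.
  move=> A B PA PB; exists (A `|` B); first exact: PU.
  by move=> C ABC; split=> x ?; apply: ABC; [left|right].
have [|A PA AK] := Kc _ F (fun A x => A x) FF.
  move=> x /Ploc[U xU PU']; exists (U, [set B | U `<=` B]).
    by split=> //; exists U.
  by move=> [y B] [/= Uy UB]; apply: UB.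
by apply: Psub (PA) => //; apply: AK => /=.
Qed.

(** The values lie in a compact segment, so the image of [U] has a cluster point, and an ultrafilter
    converges to each of its cluster points. *)
Lemma bounded_ultra_cvg (R : realType) (T : Type) (U : set_system T)
    (u : T -> R) (M : R) :
  UltraFilter U -> (forall t, `|u t| <= M) -> cvg (u @ U).
Proof.
move=> UU uM; have PU : ProperFilter U by exact: ultra_proper.
have : (u @ U) `[- M, M]%classic.
  rewrite /fmap /=; apply: (@filterS _ U _ setT); last exact: filterT.
  by move=> t _; rewrite /= in_itv /= -ler_norml.
move=> /(segment_compact (fmap_proper_filter u PU))[l [_ lU]].
apply/cvg_ex; exists l => V Vl.
have [//|nV] := in_ultra_setVsetC (u @^-1` V) UU.
have [] := lU (~` V) V nV Vl.
by move=> y [].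
Qed.

Definition bounded_seq (R : realType) (u : nat -> R) :=
  exists M, forall n, `|u n| <= M.

(** [L] is the limit along an ultrafilter finer than [\oo]; being finer, it respects inequalities
    that hold only eventually. *)
Lemma generalized_limit (R : realType) : exists L : (nat -> R) -> R,
  [/\ (forall a, L (fun=> a) = a),
      (forall u v, bounded_seq u -> bounded_seq v ->
         L (fun n => u n + v n) = L u + L v),
      (forall a u, bounded_seq u -> L (fun n => a * u n) = a * L u)
    & (forall u v, bounded_seq u -> bounded_seq v ->
         (\forall n \near \oo, u n <= v n) -> L u <= L v)].
Proof.
have [U [UU ooU]] := ultraFilterLemma (@eventually_filter).
have PU : ProperFilter U by exact: ultra_proper.
have cv u : bounded_seq u -> u @ U --> lim (u @ U).
  by move=> [M uM]; apply: (bounded_ultra_cvg UU uM).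
exists (fun u => lim (u @ U)); split.
- by move=> a; apply: cvg_lim => //; exact: cvg_cst.
- by move=> u v /cv cu /cv cv'; apply: cvg_lim => //; exact: cvgD.
- by move=> a u /cv cu; apply: cvg_lim => //; exact: cvgMr.
- by move=> u v /cv cu /cv cv' uv; apply: ler_cvg_to cu cv' _; apply: ooU.
Qed.

(** * Fractional covering numbers *)

Section covering_number.
Variables (R : realType) (T : Type).
Implicit Types (S : set (set T)) (A : set T) (f g h : T -> R) (a c t : R).

(* [covers S t f]: [f <= \sum_i c_i \1_(A_i)] for finitely many [A_i] in [S]
   and [c_i >= 0] with [\sum_i c_i = t]. *)
Inductive covers S : R -> (T -> R) -> Prop :=
| covers_nil f : (forall x, f x <= 0) -> covers S 0 f
| covers_cons c A t f : 0 <= c -> S A ->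
    covers S t (fun x => f x - c * \1_A x) -> covers S (c + t) f.

Lemma covers_ge0 S t f : covers S t f -> 0 <= t.
Proof. by elim=> // c A {}t {}f c0 _ _ t0; exact: addr_ge0. Qed.

Lemma covers_le S t f g : covers S t f -> (forall x, g x <= f x) -> covers S t g.
Proof.
move=> cf; elim: cf g => [{}f f0|c A {}t {}f c0 SA _ IH] g gf.
  by apply: covers_nil => x; exact: le_trans (gf x) (f0 x).
by apply: (covers_cons c0 SA); apply: IH => x; rewrite lerB.
Qed.

Lemma covers_bound S t f x : covers S t f -> f x <= t.
Proof.
elim=> [//|c A {}t {}f c0 _ _]; rewrite lerBlDl => /le_trans; apply.
by rewrite lerD2r ler_piMr// indicE; case: (_ \in _).
Qed.

Lemma covers_indic S A : S A -> covers S 1 (\1_A : T -> R).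
Proof.
move=> SA; rewrite -[1]addr0; apply: (covers_cons _ SA) => //.
by apply: covers_nil => x; rewrite mul1r subrr.
Qed.

Lemma coversD S t t' f g : covers S t f -> covers S t' g ->
  covers S (t + t') (fun x => f x + g x).
Proof.
move=> cf cg; elim: cf => [{}f f0|c A {}t {}f c0 SA _ IH].
  by rewrite add0r; apply: covers_le cg _ => x; rewrite gerDr.
rewrite -addrA; apply: (covers_cons c0 SA).
by apply: covers_le IH _ => x; rewrite addrAC.
Qed.

Lemma coversZ S a t f : 0 <= a -> covers S t f ->
  covers S (a * t) (fun x => a * f x).
Proof.
move=> a0; elim=> [{}f f0|c A {}t {}f c0 SA _ IH].
  by rewrite mulr0; apply: covers_nil => x; rewrite mulr_ge0_le0.
rewrite mulrDr; apply: (covers_cons (mulr_ge0 a0 c0) SA).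
by apply: covers_le IH _ => x; rewrite mulrBr mulrA.
Qed.

(** Pulling back replaces each [A] by its preimage and keeps the weights. This serves both the
    invariance under [G] and the spreading of coverings by minimality. *)
Lemma covers_preimage S (D : set T) (k : T -> T) t f :
  (forall A, S A -> S (D `&` k @^-1` A)) -> covers S t f ->
  covers S t (fun x => \1_D x * f (k x)).
Proof.
move=> Sk; elim=> [{}f f0|c A {}t {}f c0 SA _ IH].
  by apply: covers_nil => x; rewrite mulr_ge0_le0.
apply: (covers_cons c0 (Sk _ SA)); apply: covers_le IH _ => x.
by rewrite indicI /= mulrBr -[\1_(k @^-1` A) x]/(\1_A (k x)) mulrCA.
Qed.

(* The step that makes the limit of covering numbers additive: functions that
   hardly vary on the members of [S] can be factored out of a covering. *)
Lemma covers_split S (e : R) (phi psi : T -> R) t h : 0 <= e ->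
  (forall x, 0 <= phi x) -> (forall x, 0 <= psi x) ->
  (forall x, phi x + psi x <= 1) ->
  (forall A x y, S A -> A x -> A y -> phi x <= phi y + e) ->
  (forall A x y, S A -> A x -> A y -> psi x <= psi y + e) ->
  covers S t h -> exists t1 t2,
    [/\ t1 + t2 <= (1 + 2 * e) * t, covers S t1 (fun x => phi x * h x)
      & covers S t2 (fun x => psi x * h x)].
Proof.
move=> e0 phi0 psi0 ppsi1 ophi opsi.
elim=> [{}h h0|c A {}t {}h c0 SA _ [t1 [t2 [tt ct1 ct2]]]].
  exists 0, 0; split; first by rewrite addr0 mulr0.
  - by apply: covers_nil => x; rewrite mulr_ge0_le0.
  - by apply: covers_nil => x; rewrite mulr_ge0_le0.
(* An empty [A] offers no point at which to evaluate [phi] and [psi], but it also contributes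
   nothing to the covering. *)
have [[a Aa]|A0] := pselect (A !=set0); last first.
  exists t1, t2; split.
  - by rewrite (le_trans tt)// ler_wpM2l ?lerDr// addr_ge0 ?mulr_ge0.
  - apply: covers_le ct1 _ => x; rewrite indicE memNset ?mulr0 ?subr0//.
    by move=> Ax; apply: A0; exists x.
  - apply: covers_le ct2 _ => x; rewrite indicE memNset ?mulr0 ?subr0//.
    by move=> Ax; apply: A0; exists x.
have step (k : T -> R) s : (forall x, 0 <= k x) ->
    (forall x, A x -> k x <= k a + e) ->
    covers S s (fun x => k x * (h x - c * \1_A x)) ->
    covers S (c * (k a + e) + s) (fun x => k x * h x).
  move=> k0 ka cs.
  apply: (covers_cons _ SA); first by rewrite mulr_ge0// addr_ge0.
  apply: covers_le cs _ => x; rewrite mulrBr lerB// mulrCA -mulrA.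
  apply: ler_wpM2l => //; rewrite indicE; case: (boolP (x \in A)) => [|_].
    by move=> /set_mem Ax; rewrite !mulr1; exact: ka.
  by rewrite !mulr0.
(* The weight [c] of [A] is divided according to the values at [a]; as [phi a + psi a <= 1], the two
   parts sum to at most [c * (1 + 2 * e)]. *)
exists (c * (phi a + e) + t1), (c * (psi a + e) + t2); split.
- have cp : c * (phi a + psi a) <= c * 1 by exact: ler_wpM2l.
  lra.
- by apply: step => // x Ax; exact: (ophi A).
- by apply: step => // x Ax; exact: (opsi A).
Qed.

(** The [inf] of an empty set is a default value, so the lemmas below carry some [covers S t f] as a
    witness. *)
Definition covnum S f : R := inf [set t | covers S t f].

Lemma covnum_le S t f : covers S t f -> covnum S f <= t.
Proof. by apply: ge_inf; exists 0 => s; exact: covers_ge0. Qed.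

Lemma covnum_ge S c t f : covers S t f ->
  (forall s, covers S s f -> c <= s) -> c <= covnum S f.
Proof. by move=> cf cle; apply: lb_le_inf => //; exists t. Qed.

Lemma covnum_ge0 S f t : covers S t f -> 0 <= covnum S f.
Proof. by move=> /covnum_ge; apply => s; exact: covers_ge0. Qed.

Lemma covnum_mono S t f g : (forall s, covers S s g -> covers S s f) ->
  covers S t g -> covnum S f <= covnum S g.
Proof.
by move=> gf cg; apply: (covnum_ge cg) => s /gf; exact: covnum_le.
Qed.

Lemma covnumD_le S t s f g : covers S t f -> covers S s g ->
  covnum S (fun x => f x + g x) <= covnum S f + covnum S g.
Proof.
move=> cf cg; rewrite -lerBlDr; apply: (covnum_ge cf) => t' cf'.
rewrite lerBlDr -lerBlDl; apply: (covnum_ge cg) => s' cg'.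
by rewrite lerBlDl; apply: covnum_le; exact: coversD.
Qed.

Lemma covnumZ_le S a t f : 0 < a -> covers S t f ->
  covnum S (fun x => a * f x) <= a * covnum S f.
Proof.
move=> a0 cf; rewrite mulrC -ler_pdivrMr//; apply: (covnum_ge cf) => s cs.
by rewrite ler_pdivrMr// mulrC; apply: covnum_le; apply: coversZ (ltW _) _.
Qed.

Lemma covnumZ S a t f : 0 < a -> covers S t f ->
  covnum S (fun x => a * f x) = a * covnum S f.
Proof.
move=> a0 cf; apply/le_anti; rewrite (covnumZ_le a0 cf)/=.
(* The converse inequality is [covnumZ_le] for the factor [a^-1] and the function [a * f]. *)
have aV0 : 0 < a^-1 by rewrite invr_gt0.
rewrite mulrC -ler_pdivlMr// mulrC; have := covnumZ_le aV0 (coversZ (ltW a0) cf).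
by under eq_fun do rewrite mulKf ?gt_eqF//.
Qed.

Lemma covnum_split S (e : R) (phi psi h : T -> R) t : 0 <= e ->
  (forall x, 0 <= phi x) -> (forall x, 0 <= psi x) ->
  (forall x, phi x + psi x <= 1) ->
  (forall A x y, S A -> A x -> A y -> phi x <= phi y + e) ->
  (forall A x y, S A -> A x -> A y -> psi x <= psi y + e) ->
  covers S t h ->
  covnum S (fun x => phi x * h x) + covnum S (fun x => psi x * h x) <=
  (1 + 2 * e) * covnum S h.
Proof.
move=> e0 phi0 psi0 pp1 ophi opsi ch.
have e1 : 0 < 1 + 2 * e by lra.
rewrite mulrC -ler_pdivrMr//; apply: (covnum_ge ch) => s cs.
have [t1 [t2 [tt c1 c2]]] := covers_split e0 phi0 psi0 pp1 ophi opsi cs.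
rewrite ler_pdivrMr// mulrC; apply: le_trans tt.
by rewrite lerD// covnum_le.
Qed.

End covering_number.

(** * Invariant covering families and minimality *)

Section pseudogroup.
Variables (X : topologicalType) (G : set (LocalHomeo X)).
Implicit Types (A U V K : set X) (g h : LocalHomeo X).

Definition invariant_family (S : set (set X)) := forall g A, G g -> S A ->
  S (lh_dom g `&` lh_fun g @^-1` A).

Definition small_sets V : set (set X) :=
  [set A | exists2 g, G g & A `<=` lh_dom g `&` lh_fun g @^-1` V].

Lemma open_lh_preimage g V : open V -> open (lh_dom g `&` lh_fun g @^-1` V).
Proof.
move=> oV; rewrite openE => x [gx Vgx]; apply: filterI.
  by apply: open_nbhs_nbhs; split => //; exact: lh_open_dom.
have := @lh_cont_fun _ g; rewrite continuous_open_subspace; last exact: lh_open_dom.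
by move=> /(_ x (mem_set gx)); apply; exact: open_nbhs_nbhs.
Qed.

(** If [k] sends [A] into [V], then [k \o g] sends the preimage of [A] there. Composition in [G]
    asks for equality of domain and range, so [g] is first restricted to the preimage of [lh_dom k],
    then [k] to the range of that restriction. *)
Lemma small_sets_invariant V : pseudo_star_group G -> invariant_family (small_sets V).
Proof.
move=> [Gres _ Gcomp _] g A Gg [k Gk Ak].
have oU : open (lh_dom g `&` lh_fun g @^-1` lh_dom k).
  by apply: open_lh_preimage; exact: lh_open_dom.
have [h Gh [hU hg]] := Gres _ _ Gg oU (@subIsetl _ _ _).
have ranh : lh_ran h `<=` lh_dom k.
  move=> y hy; rewrite -(lh_funK hy).
  have := lh_inv_in hy; rewrite hU => -[gy ky].
  by rewrite hg.
have [k' Gk' [k'U k'k]] := Gres _ _ Gk (lh_open_ran h) ranh.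
have [m Gm [mU mk]] := Gcomp _ _ Gh Gk' k'U.
exists m => // x [gx Agx]; have [kgx Vx] := Ak _ Agx.
have hx : lh_dom h x by rewrite hU.
have gh : lh_fun h x = lh_fun g x by rewrite hg// -hU.
split; first by rewrite mU.
rewrite /= mk//= k'k ?gh//.
by rewrite -gh; exact: lh_fun_in.
Qed.

Lemma invariant_family_inv S g A : pseudo_star_group G -> invariant_family S ->
  G g -> S A -> S (lh_ran g `&` lh_inv g @^-1` A).
Proof.
move=> [_ _ _ Ginv] SG Gg SA; have [h Gh [hU hg]] := Ginv _ Gg.
suff -> : lh_ran g `&` lh_inv g @^-1` A = lh_dom h `&` lh_fun h @^-1` A.
  exact: SG.
by rewrite hU; apply/seteqP; split=> x [gx Ax]; split => //;
  move: Ax; rewrite /= hg.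
Qed.

Section covnum_invariance.
Variables (R : realType) (S : set (set X)).
Hypotheses (psG : pseudo_star_group G) (SG : invariant_family S).
Implicit Types (f : X -> R) (t : R).

Lemma covers_push g f t : G g -> covers S t f -> covers S t (push g f).
Proof.
move=> Gg cf.
have Sg A : S A -> S (lh_ran g `&` lh_inv g @^-1` A).
  exact: invariant_family_inv.
apply: covers_le (covers_preimage Sg cf) _ => x.
rewrite /push indicE; case: asboolP => gx.
  by rewrite mem_set// mul1r.
by rewrite memNset// mul0r.
Qed.

(** On [lh_dom g], [f] is the pull-back of [push g f]; elsewhere [f <= 0] costs nothing to cover. *)
Lemma covers_pull g f t : G g -> (forall x, ~ lh_dom g x -> f x <= 0) ->
  covers S t (push g f) -> covers S t f.
Proof.
move=> Gg f0 cf.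
apply: covers_le (covers_preimage (fun A SA => SG Gg SA) cf) _ => x.
rewrite indicE; have [gx|gx] := pselect (lh_dom g x).
  rewrite mem_set// mul1r /push; case: asboolP => [_|[]].
    by rewrite lh_invK.
  exact: lh_fun_in.
by rewrite memNset// mul0r f0.
Qed.

Lemma covnum_push g f : G g -> (forall x, ~ lh_dom g x -> f x <= 0) ->
  covnum S (push g f) = covnum S f.
Proof.
move=> Gg f0; congr inf; apply/seteqP; split=> t /=.
  exact: covers_pull.
exact: covers_push.
Qed.

End covnum_invariance.

(** By minimality each point has a neighbourhood that some [g] in [G] maps into [V], and the
    preimage of a covering of [V] covers it with the same weight [t]. Finitely many such
    neighbourhoods give the factor [N], chosen before [S] and [t] and hence uniform over all
    invariant families. *)
Lemma minimal_covers_compact (R : realType) V K :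
  minimal_psg G -> open V -> V !=set0 -> compact K ->
  exists2 N : R, 0 <= N & forall S t, invariant_family S ->
    covers S t (\1_V : X -> R) -> covers S (N * t) (\1_K : X -> R).
Proof.
move=> minG oV V0 cK.
apply: (compact_local_ind (P := fun K => exists2 N : R, 0 <= N &
  forall S t, invariant_family S ->
    covers S t (\1_V : X -> R) -> covers S (N * t) (\1_K : X -> R))) cK _ _ _ _.
- exists 0 => // S t _ _; rewrite mul0r; apply: covers_nil => x.
  by rewrite indic0.
- move=> A B AB [N N0 NB]; exists N => // S t SG ct.
  apply: covers_le (NB _ _ SG ct) _ => x; rewrite !indicE.
  case: (boolP (x \in A)) => [/set_mem /AB xB|_]; last by case: (_ \in _).
  by rewrite mem_set.
- move=> A B [N N0 NA] [M M0 MB]; exists (N + M); first exact: addr_ge0.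
  move=> S t SG ct; rewrite mulrDl.
  apply: covers_le (coversD (NA _ _ SG ct) (MB _ _ SG ct)) _ => x.
  by rewrite !indicE in_setU; case: (x \in A); case: (x \in B) => /=;
    rewrite ?addr0 ?add0r// lerDl.
- move=> x _; have [y [Vy [g Gg [gx gxy]]]] := minG x V V0 oV.
  exists (lh_dom g `&` lh_fun g @^-1` V).
    apply: open_nbhs_nbhs; split; first exact: open_lh_preimage.
    by split => //=; rewrite gxy.
  exists 1 => // S t SG ct; rewrite mul1r.
  apply: covers_le (covers_preimage (fun A SA => SG _ _ Gg SA) ct) _ => z.
  by rewrite indicI.
Qed.

(** [V] belongs to [small_sets V] through the identity, so [\1_V] has a covering of weight 1, which
    minimality spreads over [K]. *)
Lemma small_sets_cover (R : realType) V K :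
  pseudo_star_group G -> minimal_psg G -> open V -> V !=set0 -> compact K ->
  exists t, covers (small_sets V) t (\1_K : X -> R).
Proof.
move=> psG minG oV V0 cK; have [N _ /(_ (small_sets V) 1)] :=
  minimal_covers_compact R minG oV V0 cK.
move=> covK; exists (N * 1); apply: covK; first exact: small_sets_invariant.
apply: covers_indic; have [_ [h Gh [hT hid]] _ _] := psG.
by exists h => // x Vx; split; [rewrite hT|rewrite /= hid].
Qed.

End pseudogroup.

(** * Metric and compactness estimates *)

Section metric.
Variables (R : realType) (X : topologicalType) (d : X -> X -> R).
Hypothesis dP : is_metric_of d.

Lemma open_metric_ball x r : open [set y | d x y < r].
Proof.
case: dP => d0 d00 dC dT dN; rewrite openE => y /= xy.
apply/dN; exists (r - d x y); first by rewrite subr_gt0.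
by move=> z /= yz; have := dT x y z; lra.
Qed.

Lemma dist_continuous x : continuous (d x).
Proof.
case: dP => d0 d00 dC dT dN y; apply/cvgrPdist_lt => e e0.
apply/dN; exists e => // z /= yz.
have := dT x y z; have := dT x z y; rewrite (dC z y) ltr_norml; lra.
Qed.

Lemma compact_unif_continuous (K : set X) (f : X -> R) (e : R) :
  compact K -> continuous f -> 0 < e ->
  exists2 delta : R, 0 < delta &
    forall x y, K x -> d x y < delta -> `|f x - f y| < e.
Proof.
move=> cK cf e0; have [d0 d00 dC dT dN] := dP.
apply: (compact_local_ind (P := fun K => exists2 delta : R, 0 < delta &
    forall x y, K x -> d x y < delta -> `|f x - f y| < e)) cK _ _ _ _.
- by exists 1.
- by move=> A B AB [r r0 rB]; exists r => // x y /AB; exact: rB.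
- move=> A B [r r0 rA] [s s0 sB]; exists (Num.min r s).
    by rewrite lt_min r0.
  by move=> x y ABx; rewrite lt_min => /andP[xr xs]; case: ABx => ?;
    [exact: rA|exact: sB].
- move=> x _; have e2 : 0 < e / 2 by lra.
  have /cvgrPdist_lt/(_ _ e2)/dN[r r0 rf] := cf x.
  exists [set y | d x y < r / 2].
    by apply/dN; exists (r / 2); first lra.
  exists (r / 2); first lra.
  move=> y z /= xy yz; have := dT x y z.
  have /= fy : `|f x - f y| < e / 2 by apply: rf => /=; lra.
  move=> xz; have /= fz : `|f x - f z| < e / 2 by apply: rf => /=; lra.
  rewrite -(subrKA (f x)) (le_lt_trans (ler_normD _ _))//.
  by rewrite (distrC (f y)); lra.
Qed.

(** Equicontinuity is applied to the inverse of [g]: the images of [x] and [y] lie in a ball of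
    radius at most half the modulus, and the inverse brings them back to distance at most [e]. *)
Lemma small_sets_diam (G : set (LocalHomeo X)) x0 (e : R) :
  pseudo_star_group G -> equicontinuous_psg d G -> 0 < e ->
  exists2 delta : R, 0 < delta &
    forall r A x y, r <= delta -> small_sets G [set z | d x0 z < r] A ->
      A x -> A y -> d x y <= e.
Proof.
move=> [_ _ _ Ginv] eqG e0; have [d0 d00 dC dT dN] := dP.
have [delta delta0 Hdelta] := eqG e e0.
exists (delta / 2) => [|r A x y rd [g Gg Ag] Ax Ay]; first lra.
have [[gx /= gxr] [gy /= gyr]] := (Ag _ Ax, Ag _ Ay).
have [h Gh [hU hg]] := Ginv _ Gg.
have := Hdelta h (lh_fun g x) (lh_fun g y) Gh.
rewrite hU !hg ?lh_invK//; try exact: lh_fun_in.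
apply; [exact: lh_fun_in|exact: lh_fun_in|].
by have := dT (lh_fun g x) x0 (lh_fun g y); rewrite (dC _ x0); lra.
Qed.


End metric.

Lemma compact_bounded_fun (R : realType) (X : topologicalType) (K : set X)
    (f : X -> R) :
  compact K -> continuous f -> exists2 M : R, 0 <= M & forall x, K x -> `|f x| <= M.
Proof.
move=> cK cf.
apply: (compact_local_ind (P := fun K => exists2 M : R, 0 <= M &
  forall x, K x -> `|f x| <= M)) cK _ _ _ _.
- by exists 0.
- by move=> A B AB [M M0 MB]; exists M => // x /AB; exact: MB.
- move=> A B [M M0 MA] [N N0 NB]; exists (M + N) => [|x]; first exact: addr_ge0.
  by case=> [/MA|/NB] /le_trans; apply; rewrite ?lerDl ?lerDr.
- move=> x _; exists [set y | `|f x - f y| < 1].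
    by have /cvgrPdist_lt := cf x; exact.
  exists (`|f x| + 1) => [|y /= xy]; first by rewrite addr_ge0.
  have := lerB_dist (f y) (f x); rewrite (distrC (f y)); lra.
Qed.

(** * Compactly supported functions and linear extension of positive functionals *)

Section compactly_supported.
Variables (R : realType) (X : topologicalType) (X0 : set X).
Implicit Types f g h : X -> R.

Lemma Cc_eq0 f x : Cc X0 f -> ~ X0 x -> f x = 0.
Proof.
move=> [_ [_ fX0]] nx; apply/eqP/negPn/negP => fx.
by apply: nx; apply: fX0; apply: subset_closure.
Qed.

(** The support of [h] is a closed subset of the union of those of [f] and [g]. *)
Lemma Cc_dominated f g h : continuous h -> Cc X0 f -> Cc X0 g ->
  (forall x, f x = 0 -> g x = 0 -> h x = 0) -> Cc X0 h.
Proof.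
move=> ch [_ [cf fX0]] [_ [cg gX0]] fgh.
have sub : Defs.support h `<=` Defs.support f `|` Defs.support g.
  rewrite /Defs.support -closureU; apply: closure_subset => x /= hx.
  have [fx|] := eqVneq (f x) 0; last by left.
  right; apply/eqP => gx; move: hx; rewrite fgh ?eqxx//.
split=> //; split; last by move=> x /sub[/fX0|/gX0].
apply: subclosed_compact sub; first exact: closed_closure.
exact: compactU.
Qed.

Lemma Cc_lin a b f g : Cc X0 f -> Cc X0 g -> Cc X0 (fun x => a * f x + b * g x).
Proof.
move=> Cf Cg; apply: (Cc_dominated _ Cf Cg); last first.
  by move=> x -> ->; rewrite !mulr0 addr0.
move=> x; apply: cvgD; apply: cvgMr; [exact: Cf.1|exact: Cg.1].
Qed.

Lemma CcD f g : Cc X0 f -> Cc X0 g -> Cc X0 (fun x => f x + g x).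
Proof.
move=> Cf Cg; have := Cc_lin 1 1 Cf Cg.
by under eq_fun do rewrite !mul1r.
Qed.

Lemma CcZ a f : Cc X0 f -> Cc X0 (fun x => a * f x).
Proof.
move=> Cf; have := Cc_lin a 0 Cf Cf.
by under eq_fun do rewrite mul0r addr0.
Qed.

Definition pos_part f : X -> R := fun x => Num.max (f x) 0.
Definition neg_part f : X -> R := pos_part (fun x => - f x).

Lemma pos_part_ge0 f x : 0 <= pos_part f x.
Proof. by rewrite le_max lexx orbT. Qed.

Lemma pos_partB f x : pos_part f x - neg_part f x = f x.
Proof.
by rewrite /neg_part /pos_part; have [f0|f0] := leP (f x) 0;
  have [g0|g0] := leP (- f x) 0; lra.
Qed.

Lemma pos_part_id f : (forall x, 0 <= f x) -> pos_part f = f.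
Proof. by move=> f0; apply/funext => x; rewrite /pos_part max_l. Qed.

Lemma neg_part_id f : (forall x, 0 <= f x) -> neg_part f = (fun=> 0).
Proof.
by move=> f0; apply/funext => x; rewrite /neg_part /pos_part max_r// oppr_le0.
Qed.

Lemma Cc_pos_part f : Cc X0 f -> Cc X0 (pos_part f).
Proof.
move=> Cf; apply: (Cc_dominated _ Cf Cf); last first.
  by move=> x fx _; rewrite /pos_part fx maxxx.
by move=> x; apply: continuous_max; [exact: Cf.1|exact: cvg_cst].
Qed.

Lemma Cc_neg_part f : Cc X0 f -> Cc X0 (neg_part f).
Proof.
move=> Cf; apply: Cc_pos_part.
have := Cc_lin (- 1) 0 Cf Cf.
by under eq_fun do rewrite mulN1r mul0r addr0.
Qed.

Variable J : (X -> R) -> R.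
Hypothesis J_ge0 : forall f, Cc X0 f -> (forall x, 0 <= f x) -> 0 <= J f.
Hypothesis JD : forall f g, Cc X0 f -> Cc X0 g ->
  (forall x, 0 <= f x) -> (forall x, 0 <= g x) ->
  J (fun x => f x + g x) = J f + J g.
Hypothesis JZ : forall a f, 0 < a -> Cc X0 f -> (forall x, 0 <= f x) ->
  J (fun x => a * f x) = a * J f.

(** [J] is assumed additive and homogeneous on nonnegative functions only; this is its linear
    extension. *)
Definition signed_extension f := J (pos_part f) - J (neg_part f).

Lemma positive_functional0 f : Cc X0 f -> J (fun=> 0) = 0.
Proof.
move=> Cf; have C0 : Cc X0 (fun=> 0 : R).
  by apply: (Cc_dominated _ Cf Cf) => // x; exact: cvg_cst.
have := JD C0 C0 (fun=> lexx _) (fun=> lexx _).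
have -> : (fun=> 0 + 0) = (fun=> 0) :> (X -> R) by rewrite addr0.
lra.
Qed.

Lemma signed_extension_id f : Cc X0 f -> (forall x, 0 <= f x) ->
  signed_extension f = J f.
Proof.
move=> Cf f0; rewrite /signed_extension pos_part_id// neg_part_id//.
by rewrite (positive_functional0 Cf) subr0.
Qed.

(** Independence of the decomposition: [f - g = pos_part h - neg_part h] rearranges to an identity
    between sums of nonnegative functions, on which [J] is additive. *)
Lemma signed_extension_diff f g h : Cc X0 f -> Cc X0 g -> Cc X0 h ->
  (forall x, 0 <= f x) -> (forall x, 0 <= g x) ->
  (forall x, h x = f x - g x) -> signed_extension h = J f - J g.
Proof.
move=> Cf Cg Ch f0 g0 hE.
suff : J (pos_part h) + J g = J f + J (neg_part h).
  by rewrite /signed_extension; lra.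
have [Cp Cn] := (Cc_pos_part Ch, Cc_neg_part Ch).
rewrite -!JD//; try by move=> x; exact: pos_part_ge0.
congr J; apply/funext => x; have := pos_partB h x; have := hE x; lra.
Qed.

Lemma signed_extensionD f g : Cc X0 f -> Cc X0 g ->
  signed_extension (fun x => f x + g x) = signed_extension f + signed_extension g.
Proof.
move=> Cf Cg.
have [Cfp Cfn] := (Cc_pos_part Cf, Cc_neg_part Cf).
have [Cgp Cgn] := (Cc_pos_part Cg, Cc_neg_part Cg).
rewrite (@signed_extension_diff (fun x => pos_part f x + pos_part g x)
  (fun x => neg_part f x + neg_part g x)); first last.
- by move=> x; have := pos_partB f x; have := pos_partB g x; lra.
- by move=> x; rewrite addr_ge0// pos_part_ge0.
- by move=> x; rewrite addr_ge0// pos_part_ge0.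
- exact: CcD.
- exact: CcD.
- exact: CcD.
rewrite !JD//; try by move=> x; exact: pos_part_ge0.
by rewrite /signed_extension; lra.
Qed.

Lemma signed_extensionN f : signed_extension (fun x => - f x) = - signed_extension f.
Proof.
rewrite /signed_extension opprB; congr (_ - J _).
by rewrite /neg_part; congr pos_part; apply/funext => x; rewrite opprK.
Qed.

Lemma signed_extensionZ_gt0 a f : 0 < a -> Cc X0 f ->
  signed_extension (fun x => a * f x) = a * signed_extension f.
Proof.
move=> a0 Cf; have [Cp Cn] := (Cc_pos_part Cf, Cc_neg_part Cf).
rewrite (@signed_extension_diff (fun x => a * pos_part f x)
  (fun x => a * neg_part f x)); first last.
- by move=> x; rewrite -mulrBr pos_partB.
- by move=> x; rewrite mulr_ge0 ?(ltW a0) ?pos_part_ge0.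
- by move=> x; rewrite mulr_ge0 ?(ltW a0) ?pos_part_ge0.
- exact: CcZ.
- exact: CcZ.
- exact: CcZ.
rewrite !JZ//; try by move=> x; exact: pos_part_ge0.
by rewrite -mulrBr.
Qed.

Lemma signed_extensionZ a f : Cc X0 f ->
  signed_extension (fun x => a * f x) = a * signed_extension f.
Proof.
move=> Cf; have [a0|a0|->] := ltgtP a 0.
- have -> : (fun x => a * f x) = (fun x => - (- a * f x)).
    by apply/funext => x; rewrite mulNr opprK.
  by rewrite signed_extensionN signed_extensionZ_gt0 ?oppr_gt0// mulNr opprK.
- exact: signed_extensionZ_gt0.
- rewrite mul0r /signed_extension /neg_part.
  by under [in X in _ - X]eq_fun do rewrite mul0r oppr0;
    under [in X in X - _]eq_fun do rewrite mul0r; rewrite subrr.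
Qed.

Lemma signed_extension_radon : radon_measure X0 signed_extension.
Proof.
split=> [a b f g Cf Cg|f Cf f0]; last by rewrite signed_extension_id// J_ge0.
by rewrite signed_extensionD ?signed_extensionZ//; exact: CcZ.
Qed.

End compactly_supported.

(** * Compatibility of [push] with positive and negative parts *)

Section push_parts.
Variables (R : realType) (X : topologicalType) (g : LocalHomeo X).
Implicit Types f : X -> R.

Lemma pos_part_push f : pos_part (push g f) = push g (pos_part f).
Proof.
by apply/funext => x; rewrite /pos_part /push; case: ifP => // _; rewrite maxxx.
Qed.

Lemma neg_part_push f : neg_part (push g f) = push g (neg_part f).
Proof.
rewrite /neg_part -pos_part_push; congr pos_part; apply/funext => x.
by rewrite /push; case: ifP => // _; rewrite oppr0.
Qed.

End push_parts.

(** * Construction of the invariant measure *)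

Section invariant_measure.
Variables (R : realType) (X : topologicalType) (d : X -> X -> R).
Variables (G : set (LocalHomeo X)) (X0 : set X) (x0 : X).
Hypotheses (dP : is_metric_of d) (psG : pseudo_star_group G).
Hypotheses (minG : minimal_psg G) (eqG : equicontinuous_psg d G).
Hypotheses (oX0 : open X0) (X0x0 : X0 x0) (cX0 : compact (closure X0)).
Implicit Types (f g : X -> R) (n : nat).

Let K := closure X0.
Let S n := small_sets G [set z | d x0 z < n.+1%:R^-1].

Let X0K : X0 `<=` K. Proof. exact: subset_closure. Qed.

Let S_invariant n : invariant_family G (S n).
Proof. exact: small_sets_invariant. Qed.

Let K_cover n : exists t, covers (S n) t (\1_K : X -> R).
Proof.
apply: small_sets_cover => //; first exact: open_metric_ball.
exists x0 => /=; case: dP => _ d00 _ _ _.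
by rewrite (d00 x0 x0).2// invr_gt0.
Qed.

Let q n : R := covnum (S n) \1_K.

(** [\1_K] equals 1 at [x0], so every covering of it has total weight at least 1. *)
Let q_gt0 n : 0 < q n.
Proof.
have [t ct] := K_cover n; apply: (@lt_le_trans _ _ 1) => //.
apply: (covnum_ge ct) => s cs; have := covers_bound x0 cs.
by rewrite indicE mem_set//; exact: X0K.
Qed.

Let Cc_cover n f : Cc X0 f -> exists t, covers (S n) t f.
Proof.
move=> Cf; have [M M0 fM] := compact_bounded_fun cX0 Cf.1.
have [t ct] := K_cover n; exists (M * t); apply: covers_le (coversZ M0 ct) _ => x.
rewrite indicE; have [Kx|Kx] := pselect (K x).
  by rewrite mem_set// mulr1 (le_trans (ler_norm _))// fM.
by rewrite memNset// mulr0 (Cc_eq0 Cf)// => /X0K.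
Qed.

Definition relative_covnum n f : R := covnum (S n) f / q n.
Local Notation I := relative_covnum.

Lemma relative_covnum_ge0 n f : Cc X0 f -> 0 <= I n f.
Proof.
move=> /(Cc_cover n)[t ct]; rewrite divr_ge0// ?(ltW (q_gt0 n))//.
exact: covnum_ge0 ct.
Qed.

(** Since [f] vanishes off [K], it is dominated by [M * \1_K], whose covering number is
    [M * q n]. *)
Lemma relative_covnum_le n f (M : R) : 0 < M -> Cc X0 f ->
  (forall x, f x <= M) -> I n f <= M.
Proof.
move=> M0 Cf fM; have [t ct] := K_cover n.
rewrite ler_pdivrMr// /q -(covnumZ M0 ct).
apply: (covnum_mono (t := M * t)); last exact: coversZ (ltW M0) ct.
move=> s cs; apply: covers_le cs _ => x.
rewrite indicE; have [Kx|Kx] := pselect (K x); first by rewrite mem_set// mulr1.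
by rewrite memNset// mulr0 (Cc_eq0 Cf)// => /X0K.
Qed.

Lemma relative_covnum_bounded f : Cc X0 f -> bounded_seq (fun n => I n f).
Proof.
move=> Cf; have [M M0 fM] := compact_bounded_fun cX0 Cf.1.
exists (M + 1) => n; rewrite ger0_norm ?relative_covnum_ge0//.
apply: relative_covnum_le => //; first lra.
move=> x; have [Kx|Kx] := pselect (K x).
  by have := le_trans (ler_norm _) (fM _ Kx); lra.
by rewrite (Cc_eq0 Cf)//; [lra|move=> /X0K].
Qed.

Lemma relative_covnumD_le n f g : Cc X0 f -> Cc X0 g ->
  I n (fun x => f x + g x) <= I n f + I n g.
Proof.
move=> /(Cc_cover n)[t cf] /(Cc_cover n)[s cg].
by rewrite -mulrDl ler_pM2r ?invr_gt0//; exact: covnumD_le cf cg.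
Qed.

Lemma relative_covnumZ n a f : 0 < a -> Cc X0 f ->
  I n (fun x => a * f x) = a * I n f.
Proof.
by move=> a0 /(Cc_cover n)[t cf]; rewrite /I (covnumZ a0 cf) mulrA.
Qed.

Lemma small_osc (phi : X -> R) (e : R) : continuous phi -> 0 < e ->
  (forall x, 0 <= phi x) -> (forall x, ~ K x -> phi x = 0) ->
  \forall n \near \oo, forall A x y, S n A -> A x -> A y -> phi x <= phi y + e.
Proof.
move=> cphi e0 phi0 phiK.
have [r r0 rphi] := compact_unif_continuous dP cX0 cphi e0.
(* Equicontinuity bounds distances by a weak inequality only, hence the margin [r / 2]. *)
have r2 : 0 < r / 2 by lra.
have [s s0 sS] := small_sets_diam dP x0 psG eqG r2.
near=> n => A x y SA Ax Ay; have [Kx|/phiK ->] := pselect (K x); last first.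
  by rewrite addr_ge0// ltW.
have : d x y <= r / 2.
  apply: (sS n.+1%:R^-1 A) => //; apply: ltW.
  by near: n; exact: (near_infty_natSinv_lt (PosNum s0)).
move=> xy; have /rphi : d x y < r by lra.
by move=> /(_ Kx); rewrite ltr_norml; lra.
Unshelve. all: by end_near. Qed.

(** Approximate superadditivity. The quotients of [f] and [g] by [h = f + g + e] sum to at most 1
    and, for large [n], vary by at most [e] on the members of [S n], so [covnum_split] applies to
    [h * \1_K]. *)
Lemma relative_covnumD_ge f g (e : R) : Cc X0 f -> Cc X0 g ->
  (forall x, 0 <= f x) -> (forall x, 0 <= g x) -> 0 < e ->
  \forall n \near \oo,
    I n f + I n g <= (1 + 2 * e) * (I n (fun x => f x + g x) + e).
Proof.
move=> Cf Cg f0 g0 e0.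
(* The summand [e] keeps the denominator positive where [f] and [g] both vanish. *)
pose h x := f x + g x + e.
have h0 x : 0 < h x by rewrite ltr_wpDl// addr_ge0.
have ch : continuous h.
  by move=> x; apply: cvgD; [apply: cvgD; [exact: Cf.1|exact: Cg.1]|exact: cvg_cst].
have cdiv (k : X -> R) : continuous k -> continuous (fun x => k x / h x).
  by move=> ck x; apply: cvgM; [exact: ck|apply: cvgV; [rewrite gt_eqF|exact: ch]].
have div0 (k : X -> R) : (forall x, 0 <= k x) -> forall x, 0 <= k x / h x.
  by move=> k0 x; rewrite divr_ge0// ltW.
have divK (k : X -> R) : Cc X0 k -> forall x, ~ K x -> k x / h x = 0.
  by move=> Ck x Kx; rewrite (Cc_eq0 Ck) ?mul0r// => /X0K.
have oscf := small_osc (cdiv _ Cf.1) e0 (div0 _ f0) (divK _ Cf).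
have oscg := small_osc (cdiv _ Cg.1) e0 (div0 _ g0) (divK _ Cg).
near=> n.
have divM (k : X -> R) : Cc X0 k -> (fun x => k x / h x * (h x * \1_K x)) = k.
  move=> Ck; apply/funext => x; rewrite mulrA divfK ?gt_eqF// indicE.
  have [Kx|Kx] := pselect (K x); first by rewrite mem_set// mulr1.
  by rewrite memNset// mulr0 (Cc_eq0 Ck)// => /X0K.
have [t ct] := K_cover n; have [s cs] := Cc_cover n (CcD Cf Cg).
have ceK := coversZ (ltW e0) ct.
have hle x : h x * \1_K x <= f x + g x + e * \1_K x.
  rewrite /h indicE; case: (x \in K); rewrite ?mulr1 ?mulr0//.
  by rewrite addr0 addr_ge0.
have chK := covers_le (coversD cs ceK) hle.
have := covnum_split (ltW e0) (div0 _ f0) (div0 _ g0) _ _ _ chK.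
rewrite divM// divM// => split_le.
rewrite /I -mulrDl ler_pdivrMr// -mulrA [X in _ * X]mulrDl divfK ?gt_eqF//.
apply: le_trans (split_le _ _ _) _.
- move=> x; rewrite -mulrDl ler_pdivrMr// mul1r /h; lra.
- by near: n.
- by near: n.
- rewrite ler_wpM2l//; first lra.
  rewrite /q -(covnumZ e0 ct).
  apply: le_trans (covnumD_le cs ceK).
  apply: (covnum_mono _ (coversD cs ceK)) => s' cs'.
  exact: covers_le cs' hle.
Unshelve. all: by end_near. Qed.

Lemma exists_bump : exists b : X -> R, [/\ Cc X0 b, (forall x, 0 <= b x) &
  exists2 c : R, 0 < c & forall n, c <= I n b].
Proof.
have [d0 d00 dC dT dN] := dP.
have /dN[r r0 rX0] : nbhs x0 X0 by exact: open_nbhs_nbhs.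
pose b := pos_part (fun x => r / 2 - d x0 x).
have cb : continuous b.
  move=> x; apply: continuous_max; last exact: cvg_cst.
  by apply: cvgB; [exact: cvg_cst|exact: dist_continuous].
have supb : Defs.support b `<=` [set x | d x0 x <= r / 2].
  rewrite [X in _ `<=` X](closure_id _).1; last first.
    have -> : [set x | d x0 x <= r / 2] = d x0 @^-1` [set y | y <= r / 2] by [].
    apply: closed_comp; last exact: closed_le.
    by move=> x _; exact: dist_continuous.
  apply: closure_subset => x /=; apply: contraNT; rewrite -ltNge => xr.
  by rewrite /b /pos_part max_r//; lra.
have supX0 : Defs.support b `<=` X0.
  by move=> x /supb /= xr; apply: rX0 => /=; lra.
have Cb : Cc X0 b.
  split=> //; split=> //; apply: subclosed_compact cX0 _.
    exact: closed_closure.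
  by move=> x /supX0 /X0K.
exists b; split=> // [x|]; first exact: pos_part_ge0.
(* On this smaller ball [b >= r / 4], hence [\1_V <= 4 / r * b]. *)
pose V := [set x | d x0 x < r / 4].
have V0 : V !=set0 by exists x0; rewrite /V /= (d00 x0 x0).2//; lra.
have [N N0 NK] := minimal_covers_compact R minG (open_metric_ball dP x0 _) V0 cX0.
have r4 : 0 < 4 / r by rewrite divr_gt0.
have Vb x : \1_V x <= 4 / r * b x.
  rewrite indicE; case: (boolP (x \in V)) => [/set_mem|_]; last first.
    by apply: mulr_ge0; [exact: ltW|exact: pos_part_ge0].
  rewrite /V /= => xr; rewrite mulrAC ler_pdivlMr// mul1r.
  by have : r / 2 - d x0 x <= b x by [rewrite le_max lexx]; lra.
(* The summand 1 makes [M] positive even when [N = 0]. *)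
pose M := N * (4 / r) + 1.
have M0 : 0 < M by rewrite ltr_wpDl// mulr_ge0// ltW.
exists M^-1; first by rewrite invr_gt0.
move=> n; rewrite ler_pdivlMr// mulrC ler_pdivrMr//.
have [t ct] := Cc_cover n Cb; rewrite -ler_pdivrMr//.
apply: (covnum_ge ct) => s cs; rewrite ler_pdivrMr//.
apply: (@le_trans _ _ (N * (4 / r * s))).
  apply: covnum_le; apply: NK => //.
  exact: covers_le (coversZ (ltW r4) cs) Vb.
by rewrite mulrA [leRHS]mulrC ler_wpM2r ?(covers_ge0 cs)// /M; lra.
Qed.

Lemma exists_invariant_measure : exists mu : (X -> R) -> R,
  [/\ radon_measure X0 mu, finite_radon X0 mu, nonzero_radon X0 mu
    & invariant_radon X0 (restrict_psg G X0) mu].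
Proof.
have [L [Lc LD LZ Lle]] := generalized_limit R.
have bI f : Cc X0 f -> bounded_seq (fun n => I n f).
  exact: relative_covnum_bounded.
have bc (a : R) : bounded_seq (fun=> a) by exists `|a|.
have bD (u v : nat -> R) : bounded_seq u -> bounded_seq v ->
    bounded_seq (fun n => u n + v n).
  move=> [M uM] [N vN]; exists (M + N) => n.
  by rewrite (le_trans (ler_normD _ _))// lerD.
have bZ (a : R) (u : nat -> R) : bounded_seq u -> bounded_seq (fun n => a * u n).
  by move=> [M uM]; exists (`|a| * M) => n; rewrite normrM ler_wpM2l.
pose J f := L (fun n => I n f).
have J_ge0 f : Cc X0 f -> 0 <= J f.
  move=> Cf; rewrite -(Lc 0); apply: Lle => //; first exact: bI.
  by apply: nearW => n; exact: relative_covnum_ge0.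
have JD f g : Cc X0 f -> Cc X0 g -> (forall x, 0 <= f x) ->
    (forall x, 0 <= g x) -> J (fun x => f x + g x) = J f + J g.
  move=> Cf Cg f0 g0; have Cfg := CcD Cf Cg.
  have [[bf bg] bfg] := (bI _ Cf, bI _ Cg, bI _ Cfg).
  apply/eqP; rewrite eq_le; apply/andP; split.
    rewrite -LD//; apply: Lle => //; first exact: bD.
    by apply: nearW => n; exact: relative_covnumD_le.
  have almost (e : R) : 0 < e ->
      J f + J g <= (1 + 2 * e) * (J (fun x => f x + g x) + e).
    move=> e0; rewrite -LD// -[X in _ <= _ * (_ + X)]Lc -LD// -LZ; last exact: bD.
    apply: Lle; [exact: bD|by apply: bZ; exact: bD|].
    exact: relative_covnumD_ge.
  move: (J_ge0 _ Cfg) almost; move: (J (fun x => f x + g x)) => c c0.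
  move: (J f + J g) => a almost; rewrite leNgt; apply/negP => ca.
  have c3 : 0 < 2 * c + 3 by lra.
  (* As [e <= 1], this choice gives [(1 + 2 * e) * (c + e) <= c + e * (2 * c + 3) <= (a + c) / 2 <
     a], against [almost]. *)
  pose e := Num.min 1 ((a - c) / 2 / (2 * c + 3)).
  have e0 : 0 < e by rewrite lt_min ltr01 divr_gt0//; lra.
  have e1 : e <= 1 by rewrite ge_min lexx.
  have e2 : e * (2 * c + 3) <= (a - c) / 2.
    by rewrite -ler_pdivlMr// ge_min lexx orbT.
  have := almost _ e0; have : e * e <= e * 1 by rewrite ler_wpM2l// ltW.
  nra.
have JZ a f : 0 < a -> Cc X0 f -> (forall x, 0 <= f x) ->
    J (fun x => a * f x) = a * J f.
  move=> a0 Cf _; rewrite -LZ; last exact: bI.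
  by congr L; apply/funext => n; exact: relative_covnumZ.
exists (signed_extension J); split.
- by apply: signed_extension_radon => // f Cf _; exact: J_ge0.
- exists 1 => f Cf f01.
  rewrite (signed_extension_id JD)//; last by move=> x; case/andP: (f01 x).
  rewrite -[leRHS]Lc; apply: Lle => //; first exact: bI.
  apply: nearW => n; apply: relative_covnum_le => // x.
  by case/andP: (f01 x).
- have [b [Cb b0 [c c0 cb]]] := exists_bump; exists b => //.
  rewrite (signed_extension_id JD)// gt_eqF// (lt_le_trans c0)//.
  rewrite -[leLHS]Lc; apply: Lle => //; first exact: bI.
  by apply: nearW => n.
- move=> g f [Gg _] Cf supf.
  have f0 x : ~ lh_dom g x -> f x = 0.
    move=> ngx; apply/eqP/negPn/negP => fx; apply: ngx; apply: supf.
    exact: subset_closure.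
  (* [push g k] and [k] have the same covering number for every [n], so the two sequences under [L]
     coincide. *)
  have Jpush k : (forall x, ~ lh_dom g x -> k x <= 0) -> J (push g k) = J k.
    move=> k0; congr L; apply/funext => n.
    by rewrite /I (covnum_push psG (@S_invariant n) Gg k0).
  rewrite /signed_extension pos_part_push neg_part_push !Jpush// => x /f0 fx.
    by rewrite /neg_part /pos_part fx oppr0 maxxx.
  by rewrite /pos_part fx maxxx.
Qed.

End invariant_measure.

Theorem theorem2 (R : realType) (X : topologicalType) (d : X -> X -> R)
  (G : set (LocalHomeo X)) (X0 : set X) :
  is_metric_of d -> locally_compact [set: X] ->
  pseudo_star_group G -> minimal_psg G -> equicontinuous_psg d G ->
  open X0 -> X0 !=set0 -> compact (closure X0) ->
  exists mu : (X -> R) -> R,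
    [/\ radon_measure X0 mu, finite_radon X0 mu, nonzero_radon X0 mu
      & invariant_radon X0 (restrict_psg G X0) mu].
Proof.
move=> dP _ psG minG eqG oX0 [x0 X0x0] cX0.
exact: exists_invariant_measure dP psG minG eqG oX0 X0x0 cX0.
Qed.
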